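(* Assume $\diamondsuit^+$. Then for every ladder system $\mathbf C$ on $\omega_1$ there is an Aronszajn tree $T\subseteq 2^{<\omega_1}$ such that every monochromatic $\omega$-colouring of $\mathbf C$ has a $T$-uniformization whose domain is a Suslin tree.
   Context: $\diamondsuit^+$ asserts the existence of $(W_\alpha)_{\alpha<\omega_1}$ with each $W_\alpha$ countable such that for every $X\subseteq\omega_1$ there is a closed unbounded $D\subseteq\omega_1$ with $X\cap\alpha\in W_\alpha$ and $D\cap\alpha\in W_\alpha$ for all $\alpha\in D$. $2^{<\omega_1}$ is ordered by end-extension, and $T\subseteq 2^{<\omega_1}$ is a downward closed subset. A subtree of a tree $U$ of height $\omega_1$ is a downward closed $S\subseteq U$ in which every node has extensions in $S$ of arbitrarily large countable height; $s\upharpoonright\xi$ is the predecessor of $s$ of height $\xi$. A ladder system is $\mathbf C=(C_\alpha)_{\alpha\in\lim(\omega_1)}$ with $C_\alpha$ cofinal in $\alpha$ of order type $\omega$; a monochromatic $\omega$-colouring is $(f_\alpha)$ with each $f_\alpha:C_\alpha\to\omega$ constant. A $T$-uniformization is a map $\varphi$ on a subtree $S$ of $T$ with $\varphi(s\upharpoonright\xi)=f_\alpha(\xi)$ for every $s\in S$ of limit height $\alpha$ and all but finitely many $\xi\in C_\alpha$. An Aronszajn tree has height $\omega_1$, countable levels and no uncountable chains; a Suslin tree is an Aronszajn tree with no uncountable antichains. *)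

(* Defs.v *)
From HB Require Import structures.
From mathcomp Require Import all_boot all_order.
From mathcomp Require Import boolp classical_sets functions cardinality.

Set Implicit Arguments.
Unset Strict Implicit.
Unset Printing Implicit Defensive.

Import Order.TTheory.
Local Open Scope classical_set_scope.
Local Open Scope order_scope.

(* These conditions determine O up to a unique order isomorphism: its elements
   are the countable ordinals. *)
Definition is_omega1 (d : Order.disp_t) (O : orderType d) : Prop :=
  [/\ well_founded (fun x y : O => x < y),
      forall a : O, countable [set x : O | x < a]
    & ~ countable [set: O]].

Section Omega1.
Context {d : Order.disp_t} {O : orderType d}.

(* The ordinal a, viewed as the set of its predecessors. *)
Definition below (a : O) : set O := [set x | x < a].

Definition limit_ordinal (a : O) : Prop :=
  below a !=set0 /\ forall b, b < a -> exists2 c, b < c & c < a.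

Definition cofinal_in (A : set O) (a : O) : Prop :=
  A `<=` below a /\ forall b, b < a -> exists2 x, A x & b <= x.

Definition has_type_omega (A : set O) : Prop :=
  exists e : nat -> O, (forall m n, (m < n)%N -> e m < e n) /\ range e = A.

Definition unbounded (D : set O) : Prop :=
  forall a, exists2 x, D x & a < x.

Definition closed_in_omega1 (D : set O) : Prop :=
  forall a, limit_ordinal a -> cofinal_in (D `&` below a) a -> D a.

Definition club (D : set O) : Prop := closed_in_omega1 D /\ unbounded D.

(* Values of C at non-limit points are irrelevant. *)
Definition ladder_system (C : O -> set O) : Prop :=
  forall a, limit_ordinal a -> cofinal_in (C a) a /\ has_type_omega (C a).

(* A colouring (f_a : C a -> nat), a limit, is given by total functions whose
   values f a x for a not limit or x outside C a are irrelevant. *)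
Definition monochromatic (C : O -> set O) (f : O -> O -> nat) : Prop :=
  forall a, limit_ordinal a -> forall x y, C a x -> C a y -> f a x = f a y.

End Omega1.

Definition diamond_plus (d : Order.disp_t) (O : orderType d) : Prop :=
  exists W : O -> set (set O),
    (forall a, countable (W a)) /\
    forall X : set O, exists D : set O,
      club D /\
      forall a, D a -> W a (X `&` below a) /\ W a (D `&` below a).

(* 2^{<omega_1}: a countable ordinal a together with a function a -> 2. *)
Definition binseq (d : Order.disp_t) (O : orderType d) : Type :=
  {a : O & {x : O | x < a} -> bool}.

Section Trees.
Context {d : Order.disp_t} {O : orderType d}.
Implicit Types (s t : binseq O) (S T U : set (binseq O)).

(* In a downward closed subset of 2^{<omega_1} the height of a node is its
   length. *)
Definition ht s : O := projT1 s.

Definition ext_le s t : Prop :=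
  ht s <= ht t /\
  forall (x : O) (xs : x < ht s) (xt : x < ht t),
    projT2 s (exist _ x xs) = projT2 t (exist _ x xt).

Lemma lt_minr_ht s (a x : O) : x < Order.min a (ht s) -> x < ht s.
Proof. by rewrite lt_min => /andP[]. Qed.

(* For a <= ht s this is the predecessor of s of height a; otherwise it is s. *)
Definition restr s (a : O) : binseq O :=
  existT (fun b : O => {x : O | x < b} -> bool) (Order.min a (ht s))
    (fun x => projT2 s (exist _ (sval x) (lt_minr_ht (svalP x)))).

Definition down_closed T : Prop :=
  forall s t, ext_le s t -> T t -> T s.

Definition level T (a : O) : set (binseq O) := [set s | T s /\ ht s = a].

Definition comparable_nodes s t : Prop := ext_le s t \/ ext_le t s.

Definition chain (A : set (binseq O)) : Prop :=
  forall s t, A s -> A t -> comparable_nodes s t.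

Definition antichain (A : set (binseq O)) : Prop :=
  forall s t, A s -> A t -> s <> t -> ~ comparable_nodes s t.

Definition has_height_omega1 T : Prop := forall a, level T a !=set0.

Definition aronszajn_tree T : Prop :=
  [/\ down_closed T,
      has_height_omega1 T,
      forall a, countable (level T a)
    & forall A, A `<=` T -> chain A -> countable A].

Definition suslin_tree T : Prop :=
  aronszajn_tree T /\ forall A, A `<=` T -> antichain A -> countable A.

(* Downward closure is relative to U. *)
Definition subtree U S : Prop :=
  [/\ S `<=` U,
      forall s t, U s -> ext_le s t -> S t -> S s
    & forall s, S s -> forall a, exists t, [/\ S t, ext_le s t & a <= ht t]].

(* The map phi on S is given by a total function whose values outside S are
   irrelevant. *)
Definition uniformization T (C : O -> set O) (f : O -> O -> nat)
    S (phi : binseq O -> nat) : Prop :=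
  subtree T S /\
  forall s, S s -> limit_ordinal (ht s) ->
    finite_set [set x | C (ht s) x /\ phi (restr s x) <> f (ht s) x].

End Trees.

(* Main.v *)
Require Import Defs.
From Stdlib Require List.
From HB Require Import structures.
From mathcomp Require Import all_boot all_order.
From mathcomp Require Import boolp classical_sets functions cardinality.

(* The tree [tree] is built level by level. At a limit level [e] the countable
   set W_e gives only countably many requirements, each of which adds at most one
   cofinal branch: no added branch is a guessed one (so [tree] is
   Aronszajn), and for guesses of a colouring f and of a club D below [e] we add
   branches of the partial subtree [sys] determined by f and D.

   For a fixed colouring, D splits omega_1 into blocks. Inside a block the ladders
   can be made disjoint, so the colour of a node may depend on its height only; to
   keep freedom at limits of D, the node where a branch enters a block carries a
   label which changes these colours at finitely many heights, and every label
   occurs above every earlier node. At a limit [e] of D a fusion argument then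
   gives branches with any prescribed constant colour along almost all of C_e
   which also meet the guessed dense sets. To pass through a dense set without
   crossing ladder points, one meets it below some g in D where it is still dense,
   starting above the last point of C_e below g. Meeting the guessed dense sets
   makes the subtree Suslin. *)

Set Implicit Arguments.
Unset Strict Implicit.
Unset Printing Implicit Defensive.

Import Order.TTheory.
Local Open Scope classical_set_scope.
Local Open Scope order_scope.

(** * Countable ordinals *)

Lemma countable_subset (T : Type) (A B : set T) :
  A `<=` B -> countable B -> countable A.
Proof. by move=> AB; apply: sub_countable; exact: subset_card_le. Qed.

Lemma countable_setU (T : Type) (A B : set T) :
  countable A -> countable B -> countable (A `|` B).
Proof.
by move=> cA cB; rewrite -bigcup2E; apply: bigcup_countable => // -[|[|i]] _ //=.
Qed.

Lemma countable_img (T T' : Type) (h : T -> T') (A : set T) :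
  countable A -> countable (h @` A).
Proof. by apply: sub_countable; exact: card_image_le. Qed.

Lemma countable_enum (T : Type) (A : set T) (x0 : T) :
  countable A -> A x0 -> exists g : nat -> T, range g = A.
Proof.
move=> /countable_injP[r rinj] Ax0.
have /choice[g gP] : forall n, exists y, A y /\
    ((exists2 x, A x & r x = n) -> r y = n).
  move=> n; have [[x Ax rx]|nx] := pselect (exists2 x, A x & r x = n).
    by exists x.
  by exists x0.
exists g; apply/seteqP; split=> [_ [n _ <-]|x Ax]; first by case: (gP n).
exists (r x) => //; apply: rinj; rewrite ?inE //; first by case: (gP (r x)).
by have [_] := gP (r x); apply; exists x.
Qed.

Lemma nat_bound (h : nat -> nat) N : exists m, forall i, (i < N)%N -> (h i < m)%N.
Proof.
elim: N => [|N [m mP]]; first by exists 0%N.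
exists (maxn m (h N).+1) => i; rewrite ltnS leq_eqVlt leq_max => /orP[/eqP->|/mP->//].
by rewrite leqnn orbT.
Qed.

Lemma finite_inj_lt (T : Type) (A : set T) (r : T -> nat) (m : nat) :
  (forall x y, A x -> A y -> r x = r y -> x = y) ->
  finite_set [set x | A x /\ (r x < m)%N].
Proof.
move=> rinj; elim: m => [|m IH].
  by rewrite (_ : [set x | _] = set0) //; apply/seteqP; split=> // x [_]; rewrite ltn0.
have [[y [Ay ry]]|ny] := pselect (exists y, A y /\ r y = m).
  apply: (@sub_finite_set _ _ ([set x | A x /\ (r x < m)%N] `|` [set y])).
    move=> x /= [Ax]; rewrite ltnS leq_eqVlt => /orP[/eqP rx|]; last by left.
    by right; apply: rinj; rewrite // rx.
  by rewrite finite_setU; split=> //; exact: finite_set1.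
apply: sub_finite_set IH => x /= [Ax]; rewrite ltnS leq_eqVlt => /orP[/eqP rx|//].
by case: ny; exists x.
Qed.

(* The j-th task [(i, p)] asks for a point of [I i] with label [p]; it is given a
   point not used by earlier tasks. *)
Lemma surjective_labelling (V : Type) (I : nat -> set V) :
  (forall i (l : seq V), exists2 t, I i t & ~ List.In t l) ->
  exists k : V -> nat * nat, forall i p, exists2 t, I i t & k t = p.
Proof.
move=> Iinf.
have /choice[pick pickP] : forall q : nat * seq V, exists t,
    I q.1 t /\ ~ List.In t q.2.
  by move=> -[i l]; have [t] := Iinf i l; exists t.
pose task j : nat * (nat * nat) := odflt (0, (0, 0))%N (unpickle j).
pose l := fix l j := if j is j'.+1 then pick ((task j').1, l j') :: l j'
                     else [::].
pose t j := pick ((task j).1, l j).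
have tl j j' : (j < j')%N -> List.In (t j) (l j').
  elim: j' => // j' IH; rewrite ltnS leq_eqVlt => /orP[/eqP->|/IH]; first by left.
  by right.
have tinj j j' : t j = t j' -> j = j'.
  wlog : j j' / (j <= j')%N.
    move=> H; have [/H//|/ltnW/H {}H /esym /H //] := leqP j j'.
  rewrite leq_eqVlt => /orP[/eqP//|/tl + tt].
  by rewrite tt => /(proj2 (pickP _)).
(* A point is labelled by the task that picked it, unique by [tinj]; points never picked get the
   label of task [0]. *)
exists (fun x => (task (xget 0%N [set j | t j = x])).2) => i p.
exists (t (pickle (i, p))).
  by rewrite /t; have [+ _] := pickP ((task (pickle (i, p))).1, l (pickle (i, p)));
     rewrite /= /task pickleK.
rewrite (_ : xget _ _ = pickle (i, p)) ?/task ?pickleK //.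
apply: tinj; case: xgetP => [j _ //|].
by move=> /(_ (pickle (i, p)))/(_ erefl).
Qed.

Section CountableOrdinals.
Context {d : Order.disp_t} {O : orderType d} (hO : is_omega1 O).
Implicit Types (a b x y e : O) (A D : set O).

Lemma omega1_ind (P : O -> Prop) :
  (forall a, (forall b, b < a -> P b) -> P a) -> forall a, P a.
Proof. by move=> H; case: hO => + _ _ => /well_founded_ind; apply. Qed.

Lemma omega1_least A : A !=set0 -> exists2 a, A a & forall x, A x -> a <= x.
Proof.
move=> [x0 Ax0]; apply: contrapT => nA; move: Ax0; elim/omega1_ind: x0 => a IH Aa.
apply: nA; exists a => // x Ax; rewrite leNgt; apply/negP => xa.
exact: IH xa Ax.
Qed.

Lemma countable_le a : countable [set x : O | x <= a].
Proof.
have : countable ([set x | x < a] `|` [set a]).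
  by apply: countable_setU; [case: hO|exact: countable1].
by apply: countable_subset => x /=; rewrite le_eqVlt => /orP[/eqP|]; [right|left].
Qed.

(** Otherwise the segments up to the members of [A], countably many countable sets, would cover
    [O]. *)
Lemma strict_bound A : countable A -> exists u, forall x, A x -> x < u.
Proof.
move=> cA; apply: contrapT => nb; case: hO => _ _; apply.
have := bigcup_countable cA (fun a _ => countable_le a).
apply: countable_subset => u _; apply: contrapT => nu; apply: nb; exists u => x Ax.
by rewrite ltNge; apply/negP => ux; apply: nu; exists x.
Qed.

Lemma exists_gt a : exists b, a < b.
Proof. by have [b /(_ a erefl)] := strict_bound (countable1 a); exists b. Qed.

Lemma exists_bottom : exists o : O, forall a, o <= a.
Proof.
have [|o _ oP] := @omega1_least setT; last by exists o => a; exact: oP.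
apply: contrapT => n0; case: hO => _ _; apply; rewrite (_ : setT = set0) //.
by apply: contrapT => /eqP/set0P/n0.
Qed.

Lemma exists_succ a : exists2 b, a < b & forall c, a < c -> b <= c.
Proof. by have [|b] := @omega1_least [set b | a < b]; [exact: exists_gt|exists b]. Qed.

Lemma nonlimit_pred a :
  ~ limit_ordinal a -> below a !=set0 -> exists2 c, c < a & forall x, x < a -> x <= c.
Proof.
move=> na a0; apply: contrapT => nc; apply: na; split=> // b ba.
apply: contrapT => nb; apply: nc; exists b => // x xa; rewrite leNgt.
by apply/negP => bx; apply: nb; exists x.
Qed.

(** [e] is the supremum of the iterates of [u] at [a], where [u y] exceeds [y] and all [g i x] with
    [x <= y]. *)
Lemma closure_point (g : nat -> O -> O) a :
  exists e, [/\ a < e, limit_ordinal e & forall i x, x < e -> g i x < e].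
Proof.
have /choice[u uP] : forall y, exists u, y < u /\ forall i x, x <= y -> g i x < u.
  move=> y.
  have [|u uP] := @strict_bound ([set y] `|`
      \bigcup_i [set g i x | x in [set x | x <= y]]).
    apply: countable_setU; first exact: countable1.
    by apply: bigcup_countable => // j _; apply: countable_img; exact: countable_le.
  exists u; split; first by apply: uP; left.
  by move=> i x xy; apply: uP; right; exists i => //; exists x.
pose s n := iter n u a.
have [|e eP emin] := @omega1_least [set e | forall n, s n < e].
  have [|e eP] := @strict_bound (range s); last first.
    by exists e => n; apply: eP; exists n.
  exact: countable_img.
have sS n : s n < s n.+1 by case: (uP (s n)).
have cof x : x < e -> exists n, x <= s n.
  move=> xe; apply: contrapT => nx; have : e <= x.
    apply: emin => n; rewrite ltNge; apply/negP => xs; apply: nx; by exists n.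
  by rewrite leNgt xe.
exists e; split; first exact: (eP 0%N).
- split; first by exists a; exact: (eP 0%N).
  by move=> b /cof[n bn]; exists (s n.+1); [exact: le_lt_trans (sS n)|exact: eP].
- move=> i x /cof[n xn]; apply: lt_trans (eP n.+1).
  by case: (uP (s n)) => _; apply.
Qed.

Lemma limit_succ e x y : limit_ordinal e -> x < e -> (forall z, x < z -> y <= z) ->
  y < e.
Proof. by move=> [_ le] /le[z xz ze] /(_ z xz) yz; exact: le_lt_trans ze. Qed.

Lemma bound_finite g y (h : nat -> O) N : limit_ordinal g -> y < g ->
  (forall i, (i < N)%N -> h i < g) ->
  exists c, [/\ y < c, c < g & forall i, (i < N)%N -> h i < c].
Proof.
move=> [_ lg] yg; elim: N => [|N IH] hg; first by have [c] := lg y yg; exists c.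
have [i iN|c [yc cg hc]] := IH; first by apply: hg; exact: ltnW.
have [|c' cc' c'g] := lg (Order.max c (h N)); first by rewrite gt_max cg hg.
move: cc'; rewrite gt_max => /andP[cc' hc']; exists c'; split=> //.
  exact: lt_trans cc'.
by move=> i; rewrite ltnS leq_eqVlt => /orP[/eqP->//|/hc/lt_trans]; apply.
Qed.

(* [code a] enumerates an omega-block lying above all [code b] with [b < a]. *)
Lemma exists_pairing :
  exists code : O -> nat -> O, forall a i b j, code a i = code b j -> a = b /\ i = j.
Proof.
have [sc scP] := choice exists_gt.
have scm i x : x <= iter i sc x.
  by elim: i => //= i IH; apply: le_trans IH (ltW (scP _)).
have scs i j x : (i < j)%N -> iter i sc x < iter j sc x.
  elim: j => // j IH; rewrite ltnS leq_eqVlt => /orP[/eqP->|/IH]; first exact: scP.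
  by move/lt_trans; apply; exact: scP.
have /choice[ub ubP] : forall A, exists u, countable A -> forall x, A x -> x < u.
  move=> A; have [cA|ncA] := boolP (countable A).
    by have [u uP] := strict_bound cA; exists u.
  by have [u _] := exists_bottom; exists u.
case: (hO) => wf cbelow _.
(* By recursion, [h a] becomes a strict upper bound of all [iter i sc (h b)] with [b < a]. *)
pose F a (rec : forall b, b < a -> O) : O :=
  ub [set x | exists b (h : b < a) i, x = iter i sc (rec b h)].
pose h := Fix wf (fun _ => O) F.
have hE a : h a = ub [set x | exists2 b, b < a & exists i, x = iter i sc (h b)].
  rewrite /h Fix_eq; last first.
    by move=> x f g fg; congr F; do 2 apply: functional_extensionality_dep => ?.
  congr ub; apply/seteqP; split=> x.
    by move=> [b [ba [i ->]]]; exists b => //; exists i.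
  by move=> [b ba [i ->]]; exists b, ba, i.
have hlt a b i j : b < a -> iter i sc (h b) < iter j sc (h a).
  move=> ba; apply: lt_le_trans (scm j _); rewrite [h a]hE; apply: ubP; last first.
    by exists b => //; exists i.
  rewrite (_ : [set x | _] = \bigcup_(b in [set b | b < a])
      range (fun i => iter i sc (h b))).
    apply: bigcup_countable => // c _.
    exact: countable_img.
  apply/seteqP; split=> x.
    by move=> [c ca [k ->]]; exists c => //; exists k.
  by move=> [c ca [k _ <-]]; exists c => //; exists k.
exists (fun a i => iter i sc (h a)) => a i b j eq.
have ab : a = b.
  case: (ltgtP a b) => // /hlt lt; first by have := lt i j; rewrite eq ltxx.
  by have := lt j i; rewrite eq ltxx.
split=> //; subst b; case: (ltngtP i j) => // ij.
  by have := scs _ _ (h a) ij; rewrite eq ltxx.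
by have := scs _ _ (h a) ij; rewrite eq ltxx.
Qed.

End CountableOrdinals.

(** * Ladders and nodes *)

Section Ladders.
Context {d : Order.disp_t} {O : orderType d} (hO : is_omega1 O).
Context (C : O -> set O) (hC : ladder_system C).
Implicit Types (a b x y e : O).

Lemma ladder_enum e : limit_ordinal e -> exists lad : nat -> O,
  [/\ forall i, C e (lad i), forall x, C e x -> exists i, x = lad i,
      forall i, lad i < e /\ forall j, (i <= j)%N -> lad i <= lad j,
      forall b, b < e -> exists i, b < lad i
    & forall b, b < e -> exists N, forall i, (lad i < b) = (i < N)%N].
Proof.
move=> le; have [[Ce cof] [lad [inc rlad]]] := hC le.
have Cl i : C e (lad i) by rewrite -rlad; exists i.
have lC x : C e x -> exists i, x = lad i by rewrite -rlad => -[i _ <-]; exists i.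
have cofl b : b < e -> exists i, b <= lad i.
  by move=> /cof[x /lC[i ->]]; exists i.
have mono i j : (i <= j)%N -> lad i <= lad j.
  by rewrite leq_eqVlt => /orP[/eqP->//|/inc/ltW].
exists lad; split=> //.
- by move=> i; split; [exact: Ce|exact: mono].
- by move=> b /cofl[i bi]; exists i.+1; apply: le_lt_trans bi (inc _ _ _).
move=> b /cofl ex; case: (ex_minnP ex) => N bN Nmin; exists N => i.
apply/idP/idP => [ib|iN].
  by rewrite ltnNge; apply/negP => /mono/(le_trans bN); rewrite leNgt ib.
by rewrite ltNge; apply/negP => /Nmin; rewrite leqNgt iN.
Qed.

Lemma finite_ladder_below e b :
  limit_ordinal e -> b < e -> finite_set [set x | C e x /\ x < b].
Proof.
move=> le be; have [lad [_ lC _ _ /(_ b be)[N NP]]] := ladder_enum le.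
apply: (@sub_finite_set _ _ (lad @` `I_N)); last exact/finite_image/finite_II.
by move=> _ /= [/lC[i ->] ib]; exists i => //=; rewrite -NP.
Qed.

Lemma finite_ladderI a b : limit_ordinal a -> limit_ordinal b -> a <> b ->
  finite_set (C a `&` C b).
Proof.
wlog ab : a b / a < b.
  move=> H la lb nab; case: (ltgtP a b) => [/H|/H|//]; first exact.
  by rewrite setIC; apply => //; exact: nesym.
move=> la lb _; apply: sub_finite_set (finite_ladder_below lb ab) => x [Cax Cbx].
by split=> //; have [[+ _] _] := hC la; apply.
Qed.

(* Below a countable ordinal the ladders can be made disjoint by deleting
   finitely many points of each; [own e x] is the owner of the point [x]. *)
Lemma exists_owner (rk : O -> O -> nat) :
  (forall e x y, x <= e -> y <= e -> rk e x = rk e y -> x = y) ->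
  exists own : O -> O -> O, (forall e x, own e x <= e) /\
    forall e b, limit_ordinal b -> b <= e ->
      finite_set [set x | C b x /\ own e x <> b].
Proof.
move=> rk_inj; pose cand e x b := [/\ limit_ordinal b, b <= e & C b x].
(* The owner is the candidate of least rank; [e] is the default for points without candidates. *)
have /choice[own ownP] : forall p : O * O, exists b, b <= p.1 /\
    forall b', cand p.1 p.2 b' -> cand p.1 p.2 b /\ (rk p.1 b <= rk p.1 b')%N.
  move=> [e x] /=; have [[b0 Pb0]|nb] := pselect (exists b, cand e x b); last first.
    by exists e; split=> // b' cb'; case: nb; exists b'.
  have ex : exists n, `[< exists2 b, cand e x b & rk e b = n >].
    by exists (rk e b0); apply/asboolP; exists b0.
  case: (ex_minnP ex) => n /asboolP[b cb rb] nmin.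
  exists b; split; first by case: cb.
  by move=> b' cb'; split=> //; rewrite rb; apply: nmin; apply/asboolP; exists b'.
exists (fun e x => own (e, x)); split=> [e x|e b lb be]; first by case: (ownP (e, x)).
(* A point that [b] loses lies on the ladder of one of the finitely many other [b'] of no larger
   rank, and each of these shares finitely many points with [C b]. *)
apply: (@sub_finite_set _ _ (\bigcup_(b' in [set b' | (b' <= e /\
    (limit_ordinal b' /\ b' <> b)) /\ (rk e b' < (rk e b).+1)%N]) (C b `&` C b'))).
  move=> x /= [Cbx nown]; have [_ /(_ b)[//|]] := ownP (e, x).
  move=> [lo oe Co] rko; exists (own (e, x)) => //=.
apply: bigcup_finite; last by move=> b' [[? []]] *; apply: finite_ladderI; last exact: nesym.
by apply: finite_inj_lt => x y [xe _] [ye _]; exact: rk_inj.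
Qed.

End Ladders.

Section Nodes.
Context {d : Order.disp_t} {O : orderType d}.
Implicit Types (a b x y e : O) (s t u : binseq O) (X : set (binseq O)).

Definition mknode a (g : O -> bool) : binseq O :=
  existT (fun b : O => {x : O | x < b} -> bool) a (fun p => g (sval p)).

(** Reading a node as a total function removes the proofs of [x < ht s] from later arguments. *)
Definition bit s x : bool :=
  if pselect (x < ht s) is left h then projT2 s (exist _ x h) else false.

Lemma bitE s x (h : x < ht s) : projT2 s (exist _ x h) = bit s x.
Proof.
rewrite /bit; case: pselect => // h'; congr (projT2 s (exist _ x _)).
exact: bool_irrelevance.
Qed.

Lemma bit_mknode a g x : x < a -> bit (mknode a g) x = g x.
Proof. by move=> xa; rewrite -(@bitE (mknode a g) x xa). Qed.

Lemma ext_leP s t :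
  ext_le s t <-> ht s <= ht t /\ forall x, x < ht s -> bit s x = bit t x.
Proof.
split=> -[hst st]; split=> // x.
  by move=> xs; have xt := lt_le_trans xs hst; rewrite -!bitE; exact: st.
by move=> xs xt; rewrite !bitE; exact: st.
Qed.

Lemma node_eq s t :
  ht s = ht t -> (forall x, x < ht s -> bit s x = bit t x) -> s = t.
Proof.
case: s t => a f [b g] /= ab; subst b => fg.
congr (existT _ a _); apply: functional_extensionality_dep => -[x xa].
by have := fg x xa; rewrite -!bitE.
Qed.

Lemma ht_restr s a : a <= ht s -> ht (restr s a) = a.
Proof. by move=> /min_idPl. Qed.

Lemma bit_restr s a x : a <= ht s -> x < a -> bit (restr s a) x = bit s x.
Proof.
move=> ah xa; have xs := lt_le_trans xa ah.
have h : x < ht (restr s a) by rewrite ht_restr.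
by rewrite -(bitE h) -(bitE xs) /=; congr (projT2 s (exist _ x _)); exact: bool_irrelevance.
Qed.

Lemma ext_le_refl s : ext_le s s. Proof. exact/ext_leP. Qed.

Lemma ext_le_trans s t u : ext_le s t -> ext_le t u -> ext_le s u.
Proof.
move=> /ext_leP[st1 st2] /ext_leP[tu1 tu2]; apply/ext_leP.
split=> [|x xs]; first exact: le_trans tu1.
by rewrite st2 // tu2 //; exact: lt_le_trans st1.
Qed.

Lemma ext_le_ht s t : ext_le s t -> ht s <= ht t. Proof. by case. Qed.

Lemma ext_le_below s t u : ext_le s u -> ext_le t u -> ht s <= ht t -> ext_le s t.
Proof.
move=> /ext_leP[su1 su2] /ext_leP[tu1 tu2] st; apply/ext_leP; split=> // x xs.
by rewrite su2 // tu2 //; exact: lt_le_trans st.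
Qed.

Lemma ext_le_eq s t : ext_le s t -> ht t <= ht s -> s = t.
Proof.
move=> /ext_leP[st1 st2] ts; apply: node_eq => //.
by apply/eqP; rewrite eq_le st1.
Qed.

Lemma restr_le s a : a <= ht s -> ext_le (restr s a) s.
Proof.
by move=> ah; apply/ext_leP; rewrite ht_restr //; split=> // x xa; rewrite bit_restr.
Qed.

Lemma restr_ext s t a : ext_le s t -> a <= ht s -> restr t a = restr s a.
Proof.
move=> st ah; have at_ := le_trans ah (ext_le_ht st).
apply: ext_le_eq; rewrite ?ht_restr //.
apply: (@ext_le_below _ _ t); rewrite ?ht_restr //; first exact: restr_le.
by apply: ext_le_trans st; exact: restr_le.
Qed.

Lemma restr_ht s : restr s (ht s) = s.
Proof. by apply: ext_le_eq; rewrite ?ht_restr //; exact: restr_le. Qed.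

Lemma ext_le_restr s t : ext_le s t -> restr t (ht s) = s.
Proof. by move=> st; rewrite (restr_ext st) // restr_ht. Qed.

Lemma restr_restr s a b : a <= b -> b <= ht s -> restr (restr s b) a = restr s a.
Proof.
by move=> ab bs; rewrite -(restr_ext (restr_le bs)) // ht_restr.
Qed.

Lemma ext_le_common s t u : ext_le s u -> ext_le t u -> comparable_nodes s t.
Proof.
move=> su tu; case: (leP (ht s) (ht t)) => st; first by left; exact: ext_le_below tu st.
by right; apply: ext_le_below su (ltW st).
Qed.

Lemma succ_nodes s x : ht s < x -> (forall y, y < x -> y <= ht s) ->
  exists t0 t1, [/\ ht t0 = x, ht t1 = x, ext_le s t0, ext_le s t1
                  & ~ comparable_nodes t0 t1].
Proof.
move=> sx xs.
pose t v := mknode x (fun y => if y == ht s then v else bit s y).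
have st v : ext_le s (t v).
  apply/ext_leP; split=> [|y ys]; first exact: ltW.
  by rewrite bit_mknode ?(lt_trans ys sx) // lt_eqF.
have bt v : bit (t v) (ht s) = v by rewrite bit_mknode // eqxx.
exists (t false), (t true); split=> // -[] /ext_leP[_ /(_ (ht s) sx)]; by rewrite !bt.
Qed.

Lemma avoid_chain X s t : chain X -> ~ comparable_nodes s t -> ~ X s \/ ~ X t.
Proof.
by move=> cX nc; apply: contrapT => /not_orP[/contrapT Xs /contrapT Xt]; exact: nc (cX _ _ Xs Xt).
Qed.

Definition lower X a : set (binseq O) := [set t | X t /\ ht t < a].

Lemma lower_lower X a b : a <= b -> lower (lower X b) a = lower X a.
Proof.
move=> ab; apply/seteqP; split=> t [].
  by move=> [].
by move=> Xt ta; split=> //; split=> //; exact: lt_le_trans ab.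
Qed.

(* Recursion on the height: whether [t] belongs to the set is decided by [F]
   from the part of the set of smaller height. *)
Lemma exists_tree_rec (hO : is_omega1 O) (F : set (binseq O) -> set (binseq O)) :
  exists X, forall t, X t <-> F (lower X (ht t)) t.
Proof.
have wf : well_founded (fun s t : binseq O => ht s < ht t).
  move=> s; move: {2}(ht s) (erefl (ht s)) => a; elim/(omega1_ind hO): a s => a IH s hs.
  by constructor=> t ts; apply: (IH (ht t)) => //; rewrite -hs.
pose G s (rec : forall t, ht t < ht s -> Prop) :=
  F [set t | exists h : ht t < ht s, rec t h] s.
exists (Fix wf (fun _ => Prop) G) => b; rewrite Fix_eq; last first.
  by move=> x f g fg; congr G; do 2 apply: functional_extensionality_dep => ?.
rewrite /G (_ : [set t | _] = lower (Fix wf (fun _ => Prop) G) (ht b)) //.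
by apply/seteqP; split=> t [].
Qed.

(** The union of a chain of nodes with heights cofinal in [e] is a node of height [e]. [Inv] carries
    what is needed to continue, and [step i] records what the [i]-th step achieves. *)
Lemma fusion e (lad : nat -> O) (Inv : set (binseq O))
    (step : nat -> binseq O -> binseq O -> Prop) s0 :
  (forall x, x < e -> exists i, x < lad i) ->
  (forall i s, Inv s -> ht s < e -> exists t,
     [/\ Inv t, ext_le s t, lad i <= ht t, ht t < e & step i s t]) ->
  Inv s0 -> ht s0 < e ->
  exists (b : binseq O) (sg : nat -> binseq O), [/\ ht b = e, sg 0%N = s0,
    forall i, [/\ ext_le (sg i) b, ht (sg i) < e & Inv (sg i)],
    forall i, step i (sg i) (sg i.+1)
    & forall x, x < e -> exists i, x < ht (sg i)].
Proof.
move=> cof stepP I0 h0.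
have /choice[nx nxP] : forall p : nat * binseq O, exists t, Inv p.2 -> ht p.2 < e ->
    [/\ Inv t, ext_le p.2 t, lad p.1 <= ht t, ht t < e & step p.1 p.2 t].
  move=> [i s] /=; have [[Is hs]|n] := pselect (Inv s /\ ht s < e).
    by have [t] := stepP i s Is hs; exists t.
  by exists s => Is hs; case: n.
pose sg := fix sg i := if i is j.+1 then nx (j, sg j) else s0.
have sgI i : Inv (sg i) /\ ht (sg i) < e.
  by elim: i => //= i [I1 I2]; have [] := nxP (i, sg i) I1 I2.
have sgS i : [/\ ext_le (sg i) (sg i.+1), lad i <= ht (sg i.+1)
    & step i (sg i) (sg i.+1)].
  by have [I1 I2] := sgI i; have [] := nxP (i, sg i) I1 I2.
have sgm i j : (i <= j)%N -> ext_le (sg i) (sg j).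
  elim: j => [|j IH]; first by rewrite leqn0 => /eqP->; exact: ext_le_refl.
  rewrite leq_eqVlt ltnS => /orP[/eqP->|/IH ij]; first exact: ext_le_refl.
  by apply: ext_le_trans ij _; case: (sgS j).
pose b := mknode e (fun x => `[< exists2 i, x < ht (sg i) & bit (sg i) x >]).
exists b, sg; split=> //.
- move=> i; have [Ii hi] := sgI i; split=> //; apply/ext_leP; split; first exact: ltW.
  move=> x xi; rewrite bit_mknode; last exact: lt_trans hi.
  apply/idP/asboolP => [bx|[j xj bj]]; first by exists i.
  case/orP: (leq_total i j) => /sgm /ext_leP[_ H]; first by rewrite H.
  by rewrite -H.
- by move=> i; case: (sgS i).
- by move=> x /cof[i xi]; exists i.+1; case: (sgS i) => _ /(lt_le_trans xi).
Qed.

End Nodes.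

(** * The construction *)

Section Construction.
Context {d : Order.disp_t} {O : orderType d} (hO : is_omega1 O).
Context (C : O -> set O) (hC : ladder_system C).
Context (W : O -> set (set O)) (hW : forall a, countable (W a)).
Context (hguess : forall Y : set O, exists D : set O, club D /\
  forall a, D a -> W a (Y `&` below a) /\ W a (D `&` below a)).
Context (bot : O) (botP : forall a, bot <= a).
Context (rk : O -> O -> nat)
  (rk_inj : forall e x y, x <= e -> y <= e -> rk e x = rk e y -> x = y).
Context (own : O -> O -> O) (own_le : forall e x, own e x <= e)
  (own_finite : forall e b, limit_ordinal b -> b <= e ->
     finite_set [set x | C b x /\ own e x <> b]).
Context (code : O -> nat -> O)
  (code_inj : forall a i b j, code a i = code b j -> a = b /\ i = j).
Context (idx : set (binseq O) -> binseq O -> nat)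
  (idx_inj : forall L, countable L ->
     forall s t, L s -> L t -> idx L s = idx L t -> s = t).
Context (lab : set (set (binseq O)) -> binseq O -> nat * nat)
  (lab_onto : forall F : set (set (binseq O)), countable F ->
     (forall A, F A -> forall l, exists2 t, A t & ~ List.In t l) ->
     forall A p, F A -> exists2 t, A t & lab F t = p).
Context (sel : set (binseq O) -> binseq O) (selP : forall P, P !=set0 -> P (sel P)).

(** * Blocks, guessed sets, and the recursive definition of the trees *)

Implicit Types (a x y e g : O) (s t b : binseq O) (X U E : set (binseq O))
  (D Y Z : set O) (f : O -> nat).

(** The block of [D] containing [a] starts here and ends before [nextD D a]; below the first element
    of [D] it starts at the default [bot]. *)
Definition prevD D a : O :=
  xget bot [set g | [/\ D g, g <= a & forall g', D g' -> g' <= a -> g' <= g]].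

Definition nextD D a : O :=
  xget bot [set g | [/\ D g, a < g & forall g', D g' -> a < g' -> g <= g']].

Definition limD D e : Prop :=
  limit_ordinal e /\ forall a, a < e -> exists g, [/\ D g, a < g & g < e].

Definition cones X g : set (set (binseq O)) :=
  [set [set t | [/\ X t, ht t = g & ext_le r t]] | r in lower X g].

(* On the block of D containing [ht b] the colour depends on the height only,
   except that the label [(m, n)] of the node where [b] enters the block
   prescribes the colour [n] at the finitely many heights of rank below [m]. *)
Definition phi f D X b : nat :=
  let: (m, n) := lab (cones X (prevD D (ht b))) (restr b (prevD D (ht b))) in
  if (rk (nextD D (ht b)) (ht b) < m)%N then n else f (own (nextD D (ht b)) (ht b)).

(** A set of ordinals stands for a set of nodes: a node is coded by its height and its number within
    its level. *)
Definition guess Y U : set (binseq O) :=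
  [set t | U t /\ Y (code (ht t) (idx (level U (ht t)) t))].

Definition hits E b : Prop := exists2 x, x < ht b & E (restr b x).

Definition dense_below D X e E : Prop :=
  forall a, a < e -> exists g, [/\ D g, a < g, g < e &
    forall s, X s -> ht s < g -> exists t, [/\ X t, ht t < g, ext_le s t & E t]].

(** [n] is kept apart from [f] because a guess at level [e] determines a colouring only below
    [e]. *)
Definition seal U f n D X b : Prop :=
  finite_set [set x | C (ht b) x /\ phi f D X (restr b x) <> n] /\
  forall Y, W (ht b) Y -> dense_below D X (ht b) (guess Y U) -> hits (guess Y U) b.

Definition branch X b : Prop := forall x, x < ht b -> X (restr b x).

Definition tree_rec (F : set (binseq O) -> set (binseq O)) : set (binseq O) :=
  sval (cid (exists_tree_rec hO F)).

Lemma tree_recE F b : tree_rec F b <-> F (lower (tree_rec F) (ht b)) b.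
Proof. exact: (svalP (cid (exists_tree_rec hO F)) b). Qed.

Definition sys U f D : set (binseq O) :=
  tree_rec (fun X b => [/\ U b, branch X b
                         & limD D (ht b) -> seal U f (f (ht b)) D X b]).

Definition closed_code : set O :=
  [set e | limit_ordinal e /\ forall a i, a < e -> code a i < e].

Definition decode Y a : nat := xget 0%N [set i | Y (code a i)].

(** The requirement against uncountable chains: a branch leaves every chain guessed at its
    height. *)
Definition avoids X b : Prop :=
  forall Y, W (ht b) Y -> chain (guess Y X) -> hits (~` guess Y X) b.

Definition cand X e s : set (binseq O) :=
  [set b | [/\ ht b = e, branch X b, avoids X b & ext_le s b]].

(** [Y] guesses the code of a colouring, [Z] the club given by diamond-plus, and [n] the colour at
    [e]. *)
Definition sealed_cand X e s Y Z n : set (binseq O) :=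
  cand X e s `&` [set b | branch (sys X (decode Y) (Z `&` closed_code)) b /\
    seal X (decode Y) n (Z `&` closed_code)
      (lower (sys X (decode Y) (Z `&` closed_code)) e) b].

Definition cands X e : set (set (binseq O)) :=
  [set P | exists2 s, X s & P = cand X e s \/
     exists Y Z n, [/\ W e Y, W e Z & P = sealed_cand X e s Y Z n]].

(** At a limit each candidate set contributes at most its selected element; elsewhere every one-step
    extension is kept. *)
Definition tree : set (binseq O) :=
  tree_rec (fun X b => branch X b /\ (limit_ordinal (ht b) ->
    exists2 P, cands X (ht b) P & P b /\ b = sel P)).

Lemma branch_lower X b e : ht b <= e -> branch (lower X e) b <-> branch X b.
Proof.
move=> be; split=> H x xb; first by case: (H x xb).
by split; [exact: H|rewrite ht_restr ?(ltW xb) //; exact: lt_le_trans be].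
Qed.

Lemma treeE b : tree b <-> branch tree b /\ (limit_ordinal (ht b) ->
  exists2 P, cands (lower tree (ht b)) (ht b) P & P b /\ b = sel P).
Proof. by rewrite {1}/tree tree_recE -/tree branch_lower. Qed.

Lemma sysE U f D b : sys U f D b <-> [/\ U b, branch (sys U f D) b &
  limD D (ht b) -> seal U f (f (ht b)) D (lower (sys U f D) (ht b)) b].
Proof.
rewrite {1}/sys tree_recE -/(sys U f D).
have E := @branch_lower (sys U f D) b _ (lexx (ht b)).
by split=> -[? /E ? ?].
Qed.

Lemma down_branch (P : set (binseq O)) :
  (forall b, P b -> branch P b) -> forall s t, ext_le s t -> P t -> P s.
Proof.
move=> Pbr s t st Pt; case: (ltP (ht s) (ht t)) => h.
  by rewrite -(ext_le_restr st); exact: Pbr.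
by rewrite (ext_le_eq st h).
Qed.

Lemma tree_down s t : ext_le s t -> tree t -> tree s.
Proof. by apply: down_branch => b /treeE[]. Qed.

Lemma sys_down U f D s t : ext_le s t -> sys U f D t -> sys U f D s.
Proof. by apply: down_branch => b /sysE[]. Qed.

Lemma sys_sub U f D s : sys U f D s -> U s. Proof. by move=> /sysE[]. Qed.

Lemma prevD_le D a : prevD D a <= a.
Proof. by rewrite /prevD; case: xgetP => [g _ []|]. Qed.

Lemma prevD_eq D D' a x :
  (forall g, D g /\ g <= a <-> D' g /\ g <= x) -> prevD D a = prevD D' x.
Proof.
move=> H; rewrite /prevD; congr (xget _ _); apply/seteqP; split=> g [Dg ga gm].
  have [D'g gx] : D' g /\ g <= x by apply/H.
  split=> // g' D'g' g'x; have [] := (H g').2 (conj D'g' g'x); exact: gm.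
have [D'g gx] : D g /\ g <= a by apply/H.
split=> // g' D'g' g'x; have [] := (H g').1 (conj D'g' g'x); exact: gm.
Qed.

Lemma nextD_eq D a x :
  (forall g, D g -> (a < g) = (x < g)) -> nextD D a = nextD D x.
Proof.
move=> H; rewrite /nextD; congr (xget _ _); apply/seteqP; split=> g [Dg].
  rewrite H // => ag gm; split=> // g' Dg' ag'; apply: gm; rewrite ?H //.
by rewrite -H // => ag gm; split=> // g' Dg' ag'; apply: gm; rewrite -?H.
Qed.

Lemma nextDP D a : (exists2 g, D g & a < g) ->
  [/\ D (nextD D a), a < nextD D a & forall g, D g -> a < g -> nextD D a <= g].
Proof.
move=> [g0 Dg0 ag0].
have [|g [Dg ag] gm] := @omega1_least _ _ hO [set g | D g /\ a < g].
  by exists g0.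
apply: (xgetI bot (x := g) (P := [set g |
  [/\ D g, a < g & forall g', D g' -> a < g' -> g <= g']])).
by split=> // g' *; exact: gm.
Qed.

(** If the least upper bound of the elements of [D] up to [a] were not in [D], it would be a limit
    of them, against closedness. *)
Lemma prevDP D a : closed_in_omega1 D -> (exists2 g, D g & g <= a) ->
  [/\ D (prevD D a), prevD D a <= a & forall g, D g -> g <= a -> g <= prevD D a].
Proof.
move=> cD [g0 Dg0 g0a].
have [|u uP umin] := @omega1_least _ _ hO [set u | forall g, D g -> g <= a -> g <= u].
  by exists a.
have ua : u <= a by exact: umin.
suff Du : D u.
  by apply: (xgetI bot (x := u) (P := [set g |
    [/\ D g, g <= a & forall g', D g' -> g' <= a -> g' <= g]])).
apply: contrapT => nDu.
have ltu g : D g -> g <= a -> g < u.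
  move=> Dg ga; rewrite lt_neqAle uP // andbT; apply/eqP => gu.
  by apply: nDu; rewrite -gu.
have cof x : x < u -> exists2 g, D g /\ g <= a & x < g.
  move=> xu; apply: contrapT => ng; have : u <= x; last by rewrite leNgt xu.
  by apply: umin => g Dg ga; rewrite leNgt; apply/negP => xg; apply: ng; exists g.
apply: nDu; apply: cD.
  split; first by exists g0; exact: ltu.
  by move=> x /cof[g [Dg ga] xg]; exists g => //; exact: ltu.
split=> [g []//|x /cof[g [Dg ga] xg]]; exists g; last exact: ltW.
by split=> //; exact: ltu.
Qed.

Lemma cones_lower X e g : g < e -> cones (lower X e) g = cones X g.
Proof.
move=> ge; rewrite /cones lower_lower ?(ltW ge) //; congr (_ @` _).
apply: functional_extensionality_dep => r; apply/seteqP.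
split=> t [Xt htg rt]; split=> //; first by case: Xt.
by split=> //; rewrite htg.
Qed.

Lemma phi_lower f D X e b : ht b < e -> phi f D (lower X e) b = phi f D X b.
Proof. by move=> be; rewrite /phi cones_lower //; exact: le_lt_trans (prevD_le _ _) be. Qed.

(** * Locality: data agreeing below a limit of [D] give the same colours and subtrees there *)

Definition agree e U f D U' f' D' : Prop :=
  [/\ forall t, ht t < e -> (U t <-> U' t), forall a, a < e -> f a = f' a,
      forall a, a < e -> (D a <-> D' a) & limD D e].

Lemma agree_sym e U f D U' f' D' : agree e U f D U' f' D' -> agree e U' f' D' U f D.
Proof.
case=> HU Hf HD [le lD]; split=> [t /HU|a /Hf|a /HD|]; [by case|by []|by case|].
by split=> // a /lD[g [Dg ag ge]]; exists g; split=> //; apply/HD.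
Qed.

(** As [e] is a limit of [D], the block of a node below [e] ends below [e], and owners lie no higher
    than that end. *)
Lemma phi_local e U f D U' f' D' X b : agree e U f D U' f' D' -> ht b < e ->
  phi f D X b = phi f' D' X b.
Proof.
move=> [HU Hf HD [le lD]] be.
have pE : prevD D (ht b) = prevD D' (ht b).
  by apply: prevD_eq => g; split=> -[Dg gb]; split=> //; apply/HD => //; exact: le_lt_trans be.
have [g0 [Dg0 bg0 g0e]] := lD _ be.
have [Dn bn nmin] := nextDP (ex_intro2 _ _ g0 Dg0 bg0).
have ne : nextD D (ht b) < e by exact: le_lt_trans (nmin _ Dg0 bg0) g0e.
have nE : nextD D' (ht b) = nextD D (ht b).
  apply: xget_unique.
    split=> //; first by apply/HD.
    move=> g' Dg' bg'; case: (ltP g' e) => g'e; first by apply: nmin => //; apply/HD.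
    exact: le_trans (ltW ne) g'e.
  move=> g [D'g bg gm]; have gn : g <= nextD D (ht b) by apply: gm => //; exact/HD.
  apply/eqP; rewrite eq_le gn; apply: nmin => //; apply/HD => //.
  exact: le_lt_trans ne.
by rewrite /phi nE -pE Hf //; exact: le_lt_trans (own_le _ _) ne.
Qed.

Lemma guess_local e U U' Y t : (forall t, ht t < e -> (U t <-> U' t)) -> ht t < e ->
  guess Y U t <-> guess Y U' t.
Proof.
move=> HU te; rewrite /guess /= (HU _ te) (_ : level U (ht t) = level U' (ht t)) //.
by apply/seteqP; split=> u [Uu hu]; split=> //; apply/HU; rewrite ?hu.
Qed.

(** Height [e] itself is allowed: colours and guessed sets are evaluated only at proper
    predecessors. *)
Lemma seal_local e U f D U' f' D' n X b : agree e U f D U' f' D' -> ht b <= e ->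
  limit_ordinal (ht b) -> seal U f n D X b -> seal U' f' n D' X b.
Proof.
move=> ag be lb [s1 s2]; have [HU Hf HD _] := ag; split.
  apply: sub_finite_set s1 => x /= [Cx nx]; split=> //.
  have xb : x < ht b by have [[+ _] _] := hC lb; apply.
  rewrite (phi_local _ ag) // ht_restr ?(ltW xb) //; exact: lt_le_trans be.
move=> Y WY dY; have [|x xb gx] := s2 Y WY.
  move=> a /dY[g [Dg ag' gb gP]]; exists g; split=> //.
    by apply/HD => //; exact: lt_le_trans be.
  move=> s Xs sg; have [t [Xt tg st Yt]] := gP s Xs sg; exists t; split=> //.
  by apply/(guess_local _ HU) => //; apply: lt_trans tg (lt_le_trans gb be).
exists x => //; apply/(guess_local _ HU) => //.
by rewrite ht_restr ?(ltW xb) //; exact: lt_le_trans be.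
Qed.

Lemma sys_local e U f D U' f' D' b : agree e U f D U' f' D' -> ht b < e ->
  sys U f D b <-> sys U' f' D' b.
Proof.
move=> ag; move: {2}(ht b) (erefl (ht b)) => a; elim/(omega1_ind hO): a b => a IH b hb be.
have IHb t : ht t < ht b -> sys U f D t <-> sys U' f' D' t.
  by rewrite hb => ta; apply: (IH _ ta) => //; apply: lt_trans ta _; rewrite -hb.
have lE : lower (sys U f D) (ht b) = lower (sys U' f' D') (ht b).
  by apply/seteqP; split=> t [St tb]; split=> //; apply/IHb.
have brE : branch (sys U f D) b <-> branch (sys U' f' D') b.
  by rewrite -(@branch_lower _ b (ht b)) // lE branch_lower.
have limE : limD D (ht b) <-> limD D' (ht b).
  case: ag => _ _ HD _; split=> -[lb lD]; split=> // x /lD[g [Dg xg gb]];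
  by exists g; split=> //; apply/HD => //; exact: lt_trans be.
have [HU Hf _ _] := ag.
rewrite !sysE lE (Hf _ be); split=> -[/(HU _ be) Ub /brE bb sb]; split=> //.
  by move=> l; apply: (seal_local ag) (sb _); [exact: ltW|case: l|exact/limE].
by move=> l; apply: (seal_local (agree_sym ag)) (sb _); [exact: ltW|case: l|exact/limE].
Qed.

(** * Levels of the tree: countability and extension of nodes *)

Lemma tree_succ s t x : tree s -> ext_le s t -> ht t = x -> ht s < x ->
  (forall y, y < x -> y <= ht s) -> tree t.
Proof.
move=> Ts st tx sx xs; apply/treeE; rewrite tx; split.
  move=> y; rewrite tx => /xs ys; apply: tree_down Ts.
  by rewrite (restr_ext st ys); exact: restr_le.
move=> [_ /(_ _ sx)[y sy /xs]]; by rewrite leNgt sy.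
Qed.

Lemma limit_gt0 e : limit_ordinal e -> bot < e.
Proof. by move=> [[x xe] _]; exact: le_lt_trans (botP x) xe. Qed.

Lemma tree_root : tree (mknode bot (fun=> false)).
Proof.
apply/treeE; split=> [x /=|]; first by rewrite ltNge botP.
by move=> /limit_gt0; rewrite ltxx.
Qed.

Lemma countable_cands X e : countable X -> countable (cands X e).
Proof.
move=> cX; apply: (@countable_subset _ _ (\bigcup_(s in X) ([set cand X e s] `|`
    (fun q => sealed_cand X e s q.1.1 q.1.2 q.2) @` (W e `*` W e `*` [set: nat])))).
  move=> P [s Xs [->|[Y [Z [n [WY WZ ->]]]]]]; exists s => //; [by left|right].
  by exists (Y, Z, n).
apply: bigcup_countable => // s _; apply: countable_setU; first exact: countable1.
by apply: countable_img; apply: countableX => //; exact: countableX.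
Qed.

Lemma countable_lower X e : (forall a, a < e -> countable (level X a)) ->
  countable (lower X e).
Proof.
move=> cl; apply: (@countable_subset _ _ (\bigcup_(a in [set a | a < e]) level X a)).
  by move=> t [Xt te]; exists (ht t).
by apply: bigcup_countable => //; case: hO.
Qed.

(** A limit level is covered by the values of [sel] on countably many candidate sets; a node of
    successor height is determined by its immediate predecessor and its last bit. *)
Lemma countable_level a : countable (level tree a).
Proof.
elim/(omega1_ind hO): a => a IH.
have [la|na] := pselect (limit_ordinal a).
  apply: (@countable_subset _ _ (sel @` cands (lower tree a) a)).
    move=> t [/treeE[_]] + ta; rewrite ta => /(_ la)[P cP [_ ->]]; by exists P.
  by apply/countable_img/countable_cands/countable_lower.
have [a0|n0] := pselect (below a !=set0).
  have [c ca cm] := nonlimit_pred na a0.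
  have /countable_injP[r rinj] := IH c ca.
  apply/countable_injP; exists (fun t => pickle (r (restr t c), bit t c)) => s t.
  rewrite !inE => -[Ts hs] [Tt htt] /(pcan_inj pickleK)[rst bst].
  have cs : c <= ht s by rewrite hs ltW.
  have ct : c <= ht t by rewrite htt ltW.
  have lv u : tree u -> ht u = a -> level tree c (restr u c).
    move=> Tu hu; have cu : c <= ht u by rewrite hu ltW.
    by split; [apply: tree_down Tu; exact: restr_le|rewrite ht_restr].
  have rE : restr s c = restr t c by apply: rinj => //; rewrite inE; exact: lv.
  apply: node_eq => [|x]; first by rewrite hs.
  rewrite hs => /cm; rewrite le_eqVlt => /orP[/eqP->//|xc].
  by rewrite -(bit_restr cs xc) rE bit_restr.
apply: (@countable_subset _ _ [set mknode a (fun=> false)]); last exact: countable1.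
move=> t [_ hta]; apply: node_eq => // x; rewrite hta => xa.
by case: n0; exists x.
Qed.

Lemma countable_tree_below e : countable (lower tree e).
Proof. by apply: countable_lower => a _; exact: countable_level. Qed.

Lemma cands_sub X e P b : cands X e P -> P b ->
  [/\ ht b = e, branch X b & avoids X b].
Proof. by move=> [s Xs [->|[Y [Z [n [_ _ ->]]]]]] => [|[+ _]] => -[]. Qed.

Lemma tree_sel e P : limit_ordinal e -> cands (lower tree e) e P -> P !=set0 ->
  tree (sel P) /\ P (sel P).
Proof.
move=> le cP /selP Ps; have [hs bs _] := cands_sub cP Ps; split=> //.
apply/treeE; rewrite hs; split; last by move=> _; exists P.
by move: bs; rewrite branch_lower ?hs.
Qed.

Lemma tree_avoids b : tree b -> limit_ordinal (ht b) -> avoids (lower tree (ht b)) b.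
Proof. by move=> /treeE[_ H] /H[P cP [/(cands_sub cP)[]]]. Qed.

Lemma enum_W e : exists Yn : nat -> set O, W e `<=` range Yn.
Proof.
(* [set0] is added so that there is something to enumerate. *)
have [||Yn YE] := @countable_enum _ (W e `|` [set set0]) set0.
- by apply: countable_setU => //; exact: countable1.
- by right.
by exists Yn; rewrite YE => Y; left.
Qed.

Lemma tree_split s e : tree s -> ht s < e -> limit_ordinal e ->
  exists t0 t1, [/\ tree t0 /\ tree t1, ht t0 < e /\ ht t1 < e,
    ext_le s t0 /\ ext_le s t1, (forall x, ht s < x -> ht t0 <= x /\ ht t1 <= x)
    & ~ comparable_nodes t0 t1].
Proof.
move=> Ts se le; have [x sx xm] := exists_succ hO (ht s).
have xs y : y < x -> y <= ht s.
  by move=> yx; rewrite leNgt; apply/negP => /xm; rewrite leNgt yx.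
have [t0 [t1 [h0 h1 st0 st1 nc]]] := succ_nodes sx xs.
exists t0, t1; rewrite h0 h1; split=> //.
- by split; [exact: (tree_succ Ts st0 h0 sx xs)|exact: (tree_succ Ts st1 h1 sx xs)].
- by split; exact: limit_succ le se xm.
- by move=> y /xm.
Qed.

(** The limit case is a fusion: two incomparable extensions cannot both lie in the [i]-th guessed
    chain, so step [i] leaves that chain and then climbs to at least [lad i]. *)
Lemma tree_ext a s : tree s -> ht s < a -> exists t, [/\ tree t, ht t = a & ext_le s t].
Proof.
elim/(omega1_ind hO): a s => a IH s Ts sa.
have extle s' x : tree s' -> ht s' <= x -> x < a ->
    exists t, [/\ tree t, ht t = x & ext_le s' t].
  move=> Ts'; rewrite le_eqVlt => /orP[/eqP <- _|? ?]; last exact: IH.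
  by exists s'; split=> //; exact: ext_le_refl.
have [la|na] := pselect (limit_ordinal a); last first.
  have [|c ca cm] := nonlimit_pred na; first by exists (ht s).
  have [t [Tt tc st]] := extle s c Ts (cm _ sa) ca.
  have tm y : y < a -> y <= ht t by rewrite tc; exact: cm.
  have ta : ht t < a by rewrite tc.
  have [t0 [_ [h0 _ tt0 _ _]]] := succ_nodes ta tm.
  by exists t0; split; [exact: tree_succ tt0 h0 ta tm|by []|exact: ext_le_trans tt0].
have [lad [_ _ ladP cof _]] := ladder_enum hC la.
have lada i := proj1 (ladP i).
have [Yn YnE] := enum_W a.
have [||||b [sg [hb sg0 sgP stepP sgcof]]] := @fusion _ _ a lad tree
  (fun i _ t => chain (guess (Yn i) (lower tree a)) ->
    exists2 x, x <= ht t & ~ guess (Yn i) (lower tree a) (restr t x)) s.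
- exact: cof.
- move=> i s' Ts' s'a.
  have [t0 [t1 [[T0 T1] [h0 h1] [st0 st1] _ nc]]] := tree_split Ts' s'a la.
  have [u [Tu ua su Hu]] : exists u, [/\ tree u, ht u < a, ext_le s' u &
      chain (guess (Yn i) (lower tree a)) -> ~ guess (Yn i) (lower tree a) u].
    have [cE|] := pselect (chain (guess (Yn i) (lower tree a))); last by exists t0.
    by have [] := avoid_chain cE nc; [exists t0|exists t1].
  pose x := Order.max (ht u) (lad i).
  have [||t [Tt tx ut]] := extle u x Tu.
  + by rewrite le_max lexx.
  + by rewrite gt_max ua lada.
  exists t; split=> //.
  + exact: ext_le_trans ut.
  + by rewrite tx le_max lexx orbT.
  + by rewrite tx gt_max ua lada.
  + move=> cE; exists (ht u); first exact: ext_le_ht.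
    by rewrite ext_le_restr //; exact: Hu.
- exact: Ts.
- exact: sa.
have cb : cand (lower tree a) a s b.
  split=> //.
  - move=> x; rewrite hb => /[dup] xa /sgcof[i xi]; have [sb si Ti] := sgP i.
    rewrite (restr_ext sb) ?(ltW xi) //; split; last by rewrite ht_restr ?(ltW xi).
    by apply: tree_down Ti; apply: restr_le; exact: ltW.
  - move=> Y; rewrite hb => /YnE[i _ <-] cE; have [x xi Ex] := stepP i cE.
    have [sb si Ti] := sgP i.+1; exists x; first by rewrite hb; exact: le_lt_trans si.
    by rewrite (restr_ext sb).
  - by rewrite -sg0; case: (sgP 0%N).
(* The branch [b] need not be in the tree; it shows that this candidate set is nonempty, and the
   selected candidate is the required node. *)
have cc : cands (lower tree a) a (cand (lower tree a) a s) by exists s => //; left.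
have [Ts' [hs' _ _ ss']] := tree_sel la cc (ex_intro _ b cb).
by exists (sel (cand (lower tree a) a s)).
Qed.

Lemma tree_height a : level tree a !=set0.
Proof.
have [->|ab] := eqVneq a bot; first by
  exists (mknode bot (fun=> false)); split=> //; exact: tree_root.
have [||t [Tt hta _]] := @tree_ext a (mknode bot (fun=> false)).
- exact: tree_root.
- by rewrite lt_neqAle eq_sym ab botP.
by exists t.
Qed.

(** * Closure points, codes of sets of nodes, and the Aronszajn property *)

Lemma club_meet D R (h : O -> O) a : club D -> unbounded R ->
  exists e, [/\ a < e, D e, closed_code e, limD R e & forall x, x < e -> h x < e].
Proof.
move=> [cD uD] uR.
have /choice[nD nDP] : forall x, exists y, D y /\ x < y.
  by move=> x; have [y] := uD x; exists y.
have /choice[nR nRP] : forall x, exists y, R y /\ x < y.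
  by move=> x; have [y] := uR x; exists y.
(* Closure under [nD] and [nR] makes [e] a limit of [D] and [R]; the tail of the family gives
   closure under [code]. *)
have [e [ae le eP]] := closure_point hO (fun i => match i with
  | 0%N => nD | 1%N => nR | 2%N => h | i'.+3 => fun x => code x i' end) a.
exists e; split=> //.
- apply: cD => //; split=> [x []//|x xe]; have [Dx xlt] := nDP x.
  by exists (nD x); [split=> //; exact: (eP 0%N x)|exact: ltW].
- by split=> // x i; exact: (eP i.+3 x).
- split=> // x xe; have [Rx xlt] := nRP x.
  by exists (nR x); split=> //; exact: (eP 1%N x).
- by move=> x; exact: (eP 2%N x).
Qed.

Lemma unboundedT : unbounded [set: O].
Proof. by move=> a; have [b] := exists_gt hO a; exists b. Qed.

Definition encode E : set O :=
  [set code (ht t) (idx (level tree (ht t)) t) | t in E].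

Lemma guess_encode E e t : E `<=` tree -> closed_code e -> ht t < e ->
  guess (encode E `&` below e) tree t <-> E t.
Proof.
move=> ET [_ ec] te; split=> [[Tt [[u Eu /code_inj[hu iu]] _]]|Et].
  rewrite hu in iu.
  by have <- := idx_inj (countable_level _) (conj (ET _ Eu) hu) (conj Tt erefl) iu.
by split; [exact: ET|split; [exists t|exact: ec]].
Qed.

(** The downward closure [B] of an uncountable chain has nodes of every height. Where diamond-plus
    guesses [B] at [e], its node of height [e] has all predecessors in [B], yet the tree admits only
    branches leaving the guessed chain. *)
Lemma tree_chain (A : set (binseq O)) : A `<=` tree -> chain A -> countable A.
Proof.
move=> AT cA; apply: contrapT => nA.
have Aub c : exists2 s, A s & c <= ht s.
  apply: contrapT => nc; apply: nA; apply: countable_subset (countable_tree_below c).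
  move=> t At; split; first exact: AT.
  by rewrite ltNge; apply/negP => ct; apply: nc; exists t.
pose B := [set t | exists2 s, A s & ext_le t s].
have BT : B `<=` tree by move=> t [s As ts]; apply: tree_down ts (AT _ As).
have cB : chain B.
  move=> t t' [s As ts] [s' As' ts']; have [ss'|s's] := cA s s' As As'.
    exact: ext_le_common (ext_le_trans ts ss') ts'.
  exact: ext_le_common ts (ext_le_trans ts' s's).
have [D [clD DW]] := hguess (encode B).
have [e [_ De ec _ _]] := club_meet id bot clD unboundedT.
have [s As es] := Aub e; pose b := restr s e.
have Bb : B b by exists s => //; exact: restr_le.
have hb : ht b = e by exact: ht_restr.
have [le _] := ec.
have gE t : ht t < e -> guess (encode B `&` below e) (lower tree e) t <-> B t.
  move=> te; rewrite -(guess_encode BT ec te); apply: (guess_local (e := e)) => // u ue.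
  by split=> [[]|].
have := tree_avoids (BT _ Bb); rewrite hb => /(_ le (encode B `&` below e)).
rewrite hb => /(_ (proj1 (DW e De))) [|x xb].
  move=> t t' Gt Gt'; have [[_ te] _] := Gt; have [[_ t'e] _] := Gt'.
  by apply: cB; apply/gE.
have xh : x <= ht b by exact: ltW.
apply; apply/gE; first by rewrite ht_restr // -hb.
by exists s => //; apply: ext_le_trans (restr_le xh) _; exact: restr_le.
Qed.

Lemma tree_aronszajn : aronszajn_tree tree.
Proof.
split; [by move=> s t; exact: tree_down|exact: tree_height|exact: countable_level|].
exact: tree_chain.
Qed.

(** * The subtree of a fixed colouring *)

Section Uniformization.
Context (f : O -> nat) (D0 : set O) (D0club : club D0).
Let Xf : set O := [set code a (f a) | a in setT].
Context (D0W : forall a, D0 a -> W a (Xf `&` below a) /\ W a (D0 `&` below a)).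
Let D : set O := D0 `&` closed_code.
Let S : set (binseq O) := sys tree f D.

Lemma D_closed : closed_in_omega1 D.
Proof.
move=> a la [_ cof]; split.
  apply: (proj1 D0club) => //; split=> [x []//|b /cof[x [[Dx _] xa] bx]].
  by exists x.
split=> // b i ba; have [_ /(_ b ba)[c bc ca]] := la.
have [x [[_ [_ xc]] xa] cx] := cof c ca.
by apply: lt_trans xa; apply: xc; exact: lt_le_trans cx.
Qed.

Lemma limD_D e : limD D e -> D e.
Proof.
move=> [le lD]; apply: D_closed => //; split=> [x []//|b /lD[g [Dg bg ge]]].
by exists g => //; exact: ltW.
Qed.

Lemma D_limit g : D g -> limit_ordinal g.
Proof. by move=> [_ []]. Qed.

(** Links the true data with the guesses: [e] is closed under [code], so the truncated code of [f]
    still decodes correctly below [e]. *)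
Lemma limD_agree e : limD D e -> agree e tree f D (lower tree e)
  (decode (Xf `&` below e)) ((D0 `&` below e) `&` closed_code).
Proof.
move=> lD; have [_ [_ ec]] := limD_D lD; split=> //.
- by move=> t te; split=> [|[]].
- move=> a ae; rewrite /decode; apply/esym/xget_unique.
    by split; [exists a|exact: ec].
  by move=> i [[c _ /code_inj[-> ->]]].
- by move=> a ae; split=> [[]|[[]]].
Qed.

(** Away from limits of [D], membership in [S] asks only for membership in the tree and for the
    predecessors to be in [S]. *)
Lemma S_up s t : S s -> tree t -> ext_le s t ->
  (forall x, ht s < x -> x <= ht t -> ~ limD D x) -> S t.
Proof.
move=> Ss; move: {2}(ht t) (erefl (ht t)) => a; elim/(omega1_ind hO): a t => a IH t hta Tt st nl.
have := ext_le_ht st; rewrite le_eqVlt => /orP[/eqP e|lt].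
  by rewrite -(ext_le_eq st) // e.
apply/sysE; split=> //; last by move=> /nl; case.
move=> x xt; have hx := ht_restr (ltW xt); have rx := restr_le (ltW xt).
case: (leP (ht s) x) => sx; last first.
  apply: sys_down Ss; rewrite (restr_ext st) ?(ltW sx) //.
  by apply: restr_le; exact: ltW.
apply: (IH x) => //; first by rewrite -hta.
- exact: tree_down Tt.
- by apply: ext_le_below st rx _; rewrite hx.
- by move=> y sy; rewrite hx => yx; apply: nl => //; apply: le_trans yx (ltW xt).
Qed.

Lemma S_split s e : S s -> ht s < e -> limit_ordinal e ->
  exists t0 t1, [/\ S t0 /\ S t1, ht t0 < e /\ ht t1 < e,
    ext_le s t0 /\ ext_le s t1 & ~ comparable_nodes t0 t1].
Proof.
move=> Ss se le.
have [t0 [t1 [[T0 T1] h01 [st0 st1] hm nc]]] := tree_split (sys_sub Ss) se le.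
have nl t x : (forall x, ht s < x -> ht t <= x) -> ht s < x -> x <= ht t -> ~ limD D x.
  move=> tm sx xt [[_ /(_ _ sx)[y sy yx]] _].
  by have := lt_le_trans yx xt; rewrite ltNge tm.
exists t0, t1; split=> //; split.
  by apply: (S_up Ss) => // x; apply: nl => y /hm[].
by apply: (S_up Ss) => // x; apply: nl => y /hm[].
Qed.

(** * Extending nodes of [S] to every height *)

Definition extendible e : Prop :=
  forall s, S s -> ht s < e -> exists t, [/\ S t, ht t = e & ext_le s t].

Lemma extendible_le e : extendible e -> forall s, S s -> ht s <= e ->
  exists t, [/\ S t, ht t = e & ext_le s t].
Proof.
move=> ee s Ss; rewrite le_eqVlt => /orP[/eqP<-|]; last exact: ee.
by exists s; split=> //; exact: ext_le_refl.
Qed.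

Lemma extendible_nolim e :
  (forall x, x < e -> extendible x) -> ~ limD D e -> extendible e.
Proof.
move=> IH nle s Ss se.
(* No limit of [D] lies above [c] and up to [e], so after reaching [c] by induction any extension in
   the tree will do. *)
have [c [ce sc cm]] : exists c, [/\ c < e, ht s <= c &
    forall x, c < x -> x <= e -> ~ limD D x].
  have [le|nl] := pselect (limit_ordinal e); last first.
    have [|c ce cm] := nonlimit_pred nl; first by exists (ht s).
    exists c; split=> //; first exact: cm.
    move=> x cx; rewrite le_eqVlt => /orP[/eqP->//|/cm].
    by rewrite leNgt cx.
  have /existsNP[c /not_implyP[ce nc]] : ~ forall a, a < e -> exists g, [/\ D g, a < g & g < e].
    by move=> H; apply: nle.
  exists (Order.max c (ht s)); rewrite gt_max ce se le_max lexx orbT; split=> //.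
  move=> x; rewrite gt_max => /andP[cx _] xe [_ /(_ _ cx)[g [Dg cg gx]]].
  by apply: nc; exists g; split=> //; exact: lt_le_trans xe.
have [t [St tc st]] := extendible_le (IH c ce) Ss sc.
have [|u [Tu hu tu]] := @tree_ext e t (sys_sub St); first by rewrite tc.
exists u; split=> //; last exact: ext_le_trans tu.
by apply: (S_up St Tu tu); rewrite tc hu.
Qed.

(** Cones are infinite: above any node one can split off each node of a finite list in turn and then
    extend to [g]. Hence the labelling is onto on each cone. *)
Lemma S_label g r p : D g -> (forall x, x <= g -> extendible x) -> S r -> ht r < g ->
  exists t, [/\ S t, ht t = g, ext_le r t & lab (cones S g) t = p].
Proof.
move=> Dg ext Sr rg.
have cc : countable (cones S g).
  apply: countable_img; apply: countable_subset (countable_tree_below g).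
  by move=> t [/sys_sub].
have inf A : cones S g A -> forall l, exists2 t, A t & ~ List.In t l.
  move=> [r' [Sr' r'g] <-] l; elim: l r' Sr' r'g => [|x l IH] r' Sr' r'g.
    by have [t tP] := ext g (lexx g) r' Sr' r'g; exists t => // -[].
  have [t0 [t1 [[S0 S1] [h0 h1] [rt0 rt1] nc]]] := S_split Sr' r'g (D_limit Dg).
  have [u [Su ug ru nux]] : exists u, [/\ S u, ht u < g, ext_le r' u & ~ ext_le u x].
    have [t0x|] := pselect (ext_le t0 x); last by exists t0.
    by exists t1; split=> // t1x; apply: nc; exact: ext_le_common t0x t1x.
  have [t [St tg ut] nt] := IH u Su ug.
  exists t; first by split=> //; exact: ext_le_trans ut.
  by move=> [xt|//]; apply: nux; rewrite xt.
have [|t [St tg rt] tp] := lab_onto cc inf (A := [set t | [/\ S t, ht t = g & ext_le r t]]) p.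
  by exists r.
by exists t.
Qed.

Lemma ladder_bound e g y : limit_ordinal e -> g < e -> limit_ordinal g -> y < g ->
  exists c, [/\ y < c, c < g & forall x, C e x -> x < g -> x < c].
Proof.
move=> le ge lg yg; have [lad [_ lC _ _ /(_ g ge)[N NP]]] := ladder_enum hC le.
have [|c [yc cg cP]] := @bound_finite _ _ g y lad N lg yg; first by move=> i; rewrite NP.
by exists c; split=> // x /lC[i ->]; rewrite NP => /cP.
Qed.

(* Only ladder points at or above the next element of D can be controlled: the
   colours on the rest of the current block are already decided by [s]. *)
Lemma steer e n g s : limit_ordinal e -> (forall x, x < e -> extendible x) ->
  D g -> g < e -> S s -> ht s < g ->
  exists t, [/\ S t, ht t < g, ext_le s t, forall x, C e x -> x < g -> x < ht t
    & forall x, C e x -> x < g -> (exists g', [/\ D g', ht s < g' & g' <= x]) ->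
        phi f D S (restr t x) = n].
Proof.
move=> le ext; elim/(omega1_ind hO): g s => g IH s Dg ge Ss sg.
have [lad [Cl lC ladP _ /(_ g ge)[N NP]]] := ladder_enum hC le.
have [c [sc cg cP]] := ladder_bound le ge (D_limit Dg) sg.
have ce := lt_trans cg ge.
have [ex|nex] := pselect (exists x, [/\ C e x, x < g &
    exists g', [/\ D g', ht s < g' & g' <= x]]); last first.
  have [t [St tc st]] := ext c ce s Ss sc.
  exists t; rewrite tc; split=> // x Cx xg xg'; case: nex; by exists x.
have [x0 [/lC[i0 ->]]] := ex; rewrite NP => i0N [g' [Dg' sg' g'x0]].
have Np : (0 < N)%N by exact: leq_ltn_trans i0N.
have N0 : (N.-1 < N)%N by rewrite prednK.
(* The last point of [C e] below [g]; [N] counts such points and is positive here. *)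
pose z := lad N.-1.
have zmax x : C e x -> x < g -> x <= z.
  move=> /lC[i ->]; rewrite NP => iN; apply: (proj2 (ladP i)).
  by rewrite -ltnS prednK.
have zg : z < g by rewrite NP.
have x0z : lad i0 <= z.
  by apply: (proj2 (ladP i0)); rewrite -ltnS prednK.
(* [p] starts the block of [z]: ladder points below [p] are handled by induction, and those from [p]
   to [z] share this block. *)
have [|Dp pz pmax] := @prevDP D z D_closed.
  by exists g' => //; exact: le_trans x0z.
set p := prevD D z in Dp pz pmax.
have sp : ht s < p by apply: lt_le_trans sg' _; apply: pmax => //; exact: le_trans x0z.
have pg := le_lt_trans pz zg; have pe := lt_trans pg ge.
have [t0 [St0 t0p st0 t0C t0phi]] := IH p pg s Dp pe Ss sp.
(* [m] exceeds the ranks of all ladder points below [g], so the label [(m, n)] at [p] forces the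
   colour [n] on those from [p] on. *)
have [m mP] := nat_bound (fun i => rk (nextD D z) (lad i)) N.
have [|t1 [St1 t1p t01 labt1]] := S_label (m, n) Dp _ St0 t0p.
  by move=> x xp; apply: ext; exact: le_lt_trans pe.
have zc : z < c by exact: cP (Cl _) zg.
have t1c : ht t1 < c by rewrite t1p; exact: le_lt_trans zc.
have [t [St tc t1t]] := ext c ce t1 St1 t1c.
exists t; rewrite tc; split=> //.
  by apply: ext_le_trans t1t; exact: ext_le_trans t01.
move=> x Cx xg xg'; have xc := cP x Cx xg.
case: (ltP x p) => xp.
  have xt0 := t0C x Cx xp.
  rewrite (restr_ext (ext_le_trans t01 t1t)) ?(ltW xt0) //; exact: t0phi.
have xz := zmax x Cx xg.
have hx : ht (restr t x) = x by rewrite ht_restr ?tc ?(ltW xc).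
have px : prevD D x = p.
  apply: prevD_eq => g1; split=> -[Dg1 g1x]; split=> //; first exact: le_trans xz.
  by apply: le_trans xp; exact: pmax.
have nx : nextD D x = nextD D z.
  apply: nextD_eq => g1 Dg1; apply/idP/idP; last exact: le_lt_trans.
  move=> xg1; rewrite ltNge; apply/negP => /(pmax _ Dg1)/le_trans/(_ xp).
  by rewrite leNgt xg1.
rewrite /phi hx px nx restr_restr ?tc ?(ltW xc) // -t1p ext_le_restr // t1p labt1.
by have [i xi] := lC x Cx; rewrite xi mP // -NP -xi.
Qed.

Lemma generic_branch e n s (F : set (set (binseq O))) :
  limD D e -> (forall x, x < e -> extendible x) -> countable F ->
  (forall E, F E -> dense_below D S e E) -> S s -> ht s < e ->
  exists b, [/\ ht b = e, branch S b, ext_le s b,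
    finite_set [set x | C e x /\ phi f D S (restr b x) <> n]
    & forall E, F E -> hits E b].
Proof.
move=> [le lD] ext cF dF Ss se.
have [lad [Cl lC ladP cof _]] := ladder_enum hC le.
have [En EnE] : exists En : nat -> set (binseq O), range En = F `|` [set setT].
  apply: countable_enum; last by right.
  by apply: countable_setU => //; exact: countable1.
have dT : dense_below D S e setT.
  move=> a /lD[g [Dg ag ge]]; exists g; split=> // t St tg; exists t; split=> //.
  exact: ext_le_refl.
have dE i : dense_below D S e (En i).
  have : range En (En i) by exists i.
  by rewrite EnE => -[/dF|->].
(* [s] is first raised past the ladder points below [g0], which starts the invariant; only points
   below [c] can be exceptional. *)
have [g0 [Dg0 sg0 g0e]] := lD _ se.
have [c [sc cg0 cP]] := ladder_bound le g0e (D_limit Dg0) sg0.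
have [s0 [Ss0 s0c ss0]] := ext c (lt_trans cg0 g0e) s Ss sc.
(* No ladder point lies between [ht t] and [g], so [g] separates [t] from all later ones, as [steer]
   requires. *)
pose Inv t := S t /\ exists g, [/\ D g, ht t < g, g < e &
  forall x, C e x -> ht t <= x -> g <= x].
pose step i s t := (exists2 x, x <= ht t & En i (restr t x)) /\
  forall x, C e x -> ht s <= x -> x < ht t -> phi f D S (restr t x) = n.
have [||||b [sg [hb sgE sgP stepP sgcof]]] := @fusion _ _ e lad Inv step s0.
- exact: cof.
- move=> i t [St [g [Dg tg ge gC]]] te.
  have [|g1 [Dg1 + g1e gd]] := dE i (Order.max g (lad i)).
    by rewrite gt_max ge (proj1 (ladP i)).
  rewrite gt_max => /andP[gg1 lg1].
  (* After [steer] all ladder points below [g1] lie below [ht t0]; the dense set is then met below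
     [g1] without crossing another one. *)
  have [t0 [St0 t0g tt0 t0C t0phi]] := steer n le ext Dg1 g1e St (lt_trans tg gg1).
  have [u [Su ug t0u Eu]] := gd t0 St0 t0g.
  have Cu x : C e x -> x < g1 -> x < ht t0 /\ x < ht u.
    by move=> Cx /(t0C _ Cx) xt0; split=> //; apply: lt_le_trans xt0 (ext_le_ht t0u).
  exists u; split.
  + split=> //; exists g1; split=> // x Cx ux; rewrite leNgt; apply/negP => /(Cu _ Cx)[_].
    by rewrite ltNge ux.
  + exact: ext_le_trans t0u.
  + by have [_ /ltW] := Cu _ (Cl i) lg1.
  + exact: lt_trans g1e.
  + split; first by exists (ht u); rewrite ?restr_ht.
    move=> x Cx tx xu; have xg1 := lt_trans xu ug; have [xt0 _] := Cu x Cx xg1.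
    rewrite (restr_ext t0u) ?(ltW xt0) //; apply: t0phi => //.
    by exists g; split=> //; exact: gC.
- split=> //; exists g0; rewrite s0c; split=> // x Cx cx; rewrite leNgt.
  by apply/negP => /(cP x Cx); rewrite ltNge cx.
- by rewrite s0c; exact: lt_trans g0e.
have restrb i x : x <= ht (sg i) -> restr b x = restr (sg i) x.
  by have [sb _ _] := sgP i; exact: restr_ext.
exists b; split=> //.
- move=> x; rewrite hb => /sgcof[i xi]; rewrite (restrb i) ?(ltW xi) //.
  by have [_ _ [Si _]] := sgP i; apply: sys_down Si; apply: restr_le; exact: ltW.
- by apply: ext_le_trans ss0 _; rewrite -sgE; case: (sgP 0%N).
- apply: sub_finite_set (finite_ladder_below hC le (lt_trans cg0 g0e)).
  move=> x /= [Cx nphi]; split=> //; rewrite ltNge; apply/negP => cx; apply: nphi.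
  have xe : x < e by have [[+ _] _] := hC le; apply.
  case: (ex_minnP (sgcof x xe)) => -[|i] xi imin.
    by move: xi; rewrite sgE s0c ltNge cx.
  rewrite (restrb i.+1) ?(ltW xi) //; apply: (proj2 (stepP i)) => //.
  by rewrite leNgt; apply/negP => /imin; rewrite ltnn.
- move=> E FE; have [i _ <-] : range En E by rewrite EnE; left.
  have [[x xi Ex] _] := stepP i; have [_ si _] := sgP i.+1.
  by exists x; [rewrite hb; exact: le_lt_trans si|rewrite (restrb i.+1)].
Qed.

(** The correct guesses together with the colour [f e] form one of the candidate sets; a generic
    branch shows it nonempty, and locality puts its selected node into [S]. *)
Lemma extendible_lim e :
  (forall x, x < e -> extendible x) -> limD D e -> extendible e.
Proof.
move=> ext lD s Ss se; have [le cofD] := lD.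
have ag := limD_agree lD; have [D0e _] := limD_D lD; have [WX WD] := D0W D0e.
(* Meeting complements of guessed chains gives [avoids]; they are dense because nodes of [S]
   split. *)
pose F := [set E | dense_below D S e E] `&` (guess^~ tree @` W e `|`
  (fun Y => ~` guess Y (lower tree e)) @` W e).
have cF : countable F.
  apply: countable_subset (@subIsetr _ _ _) _.
  by apply: countable_setU; exact: countable_img.
have dF E : F E -> dense_below D S e E by case.
have [b [hb brb sb finb hitb]] := generic_branch (f e) lD ext cF dF Ss se.
have treeb : branch (lower tree e) b.
  by apply/branch_lower; rewrite ?hb // => x xb; apply: sys_sub; exact: brb.
have lSE : lower S e = lower (sys (lower tree e) (decode (Xf `&` below e))
    ((D0 `&` below e) `&` closed_code)) e.
  by apply/seteqP; split=> t [St te]; split=> //; apply/(sys_local ag te).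
have sealb : seal tree f (f e) D (lower S e) b.
  split; rewrite hb.
    apply: sub_finite_set finb => x /= [Cx nx]; split=> //.
    have xe : x < e by have [[+ _] _] := hC le; apply.
    by rewrite -(phi_lower _ _ _ (e := e)) // ht_restr // hb ltW.
  move=> Y WY dY; apply: hitb; split; last by left; exists Y.
  move=> a /dY[g [Dg ag' ge gP]]; exists g; split=> // t St tg.
  have [|u [[Su _] ug tu Yu]] := gP t _ tg; first by split=> //; exact: lt_trans ge.
  by exists u.
have avb : avoids (lower tree e) b.
  move=> Y; rewrite hb => WY cY; apply: hitb; split; last by right; exists Y.
  move=> a /cofD[g [Dg ag' ge]]; exists g; split=> // t St tg.
  have [t0 [t1 [[S0 S1] [h0 h1] [st0 st1] nc]]] := S_split St tg (D_limit Dg).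
  by have [] := avoid_chain cY nc; [exists t0|exists t1].
pose P := sealed_cand (lower tree e) e s (Xf `&` below e) (D0 `&` below e) (f e).
have cP : cands (lower tree e) e P.
  exists s; first by split=> //; exact: sys_sub Ss.
  by right; exists (Xf `&` below e), (D0 `&` below e), (f e).
have brE t : ht t = e -> branch (sys (lower tree e) (decode (Xf `&` below e))
    ((D0 `&` below e) `&` closed_code)) t <-> branch S t.
  by move=> te; rewrite -(@branch_lower _ _ e) ?te // -lSE branch_lower ?te.
have Pb : P b.
  split=> //; split; first by apply/brE.
  by rewrite -lSE; apply: seal_local ag _ _ sealb; rewrite hb.
have [Tt [[hsel _ _ ss] [brsel sealsel]]] := tree_sel le cP (ex_intro _ b Pb).
exists (sel P); split=> //; apply/sysE; split=> //; first by apply/brE.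
rewrite hsel => _; rewrite -/S lSE.
by apply: seal_local (agree_sym ag) _ _ sealsel; rewrite hsel.
Qed.

Lemma S_ext e : extendible e.
Proof.
elim/(omega1_ind hO): e => e IH.
by have [/(extendible_lim IH)|/(extendible_nolim IH)] := pselect (limD D e).
Qed.

(** * Uniformization and the Suslin property *)

Lemma S_root : S (mknode bot (fun=> false)).
Proof.
apply/sysE; split; [exact: tree_root|by move=> x /=; rewrite ltNge botP|].
by move=> [/limit_gt0]; rewrite ltxx.
Qed.

Lemma D_unbounded : unbounded D.
Proof.
move=> a; have [e [ae De ec _ _]] := club_meet id a D0club unboundedT.
by exists e.
Qed.

(** At limits of [D] this is the seal. Otherwise a final part of the ladder lies in one block, where
    exceptions are points with another owner or of rank below [m], finitely many in each case. *)
Lemma S_uniformizes s : S s -> limit_ordinal (ht s) ->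
  finite_set [set x | C (ht s) x /\ phi f D S (restr s x) <> f (ht s)].
Proof.
move=> Ss ls; have Cs x : C (ht s) x -> x < ht s by have [[+ _] _] := hC ls; apply.
have [lD|nlD] := pselect (limD D (ht s)).
  have [_ _ /(_ lD)[fin _]] := (sysE _ _ _ _).1 Ss.
  apply: sub_finite_set fin => x /= [Cx nx]; split=> //; have xs := Cs _ Cx.
  by rewrite phi_lower // ht_restr // ltW.
have /existsNP[c /not_implyP[cs nc]] :
    ~ forall a, a < ht s -> exists g, [/\ D g, a < g & g < ht s].
  by move=> H; apply: nlD.
have nD g : D g -> c < g -> ht s <= g.
  by move=> Dg cg; rewrite leNgt; apply/negP => gs; apply: nc; exists g.
have [Dn cn nmin] : [/\ D (nextD D c), c < nextD D c &
    forall g, D g -> c < g -> nextD D c <= g].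
  by apply: nextDP; have [g] := D_unbounded c; exists g.
have sn : ht s <= nextD D c by exact: nD.
case labE : (lab (cones S (prevD D c)) (restr s (prevD D c))) => [m n].
apply: (@sub_finite_set _ _ ([set x | C (ht s) x /\ x < c] `|`
    [set x | C (ht s) x /\ own (nextD D c) x <> ht s] `|`
    [set x | x <= nextD D c /\ (rk (nextD D c) x < m)%N])).
  move=> x /= [Cx nx]; have xs := Cs x Cx.
  case: (ltP x c) => xc; first by left; left.
  have hx : ht (restr s x) = x by rewrite ht_restr ?(ltW xs).
  have gc g : D g -> g <= x -> g <= c.
    move=> Dg gx; rewrite leNgt; apply/negP => /(nD _ Dg) sg.
    by have := le_lt_trans (le_trans sg gx) xs; rewrite ltxx.
  have px : prevD D x = prevD D c.
    apply: prevD_eq => g; split=> -[Dg gx]; split=> //; first exact: gc.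
    exact: le_trans xc.
  have nextx : nextD D x = nextD D c.
    apply: nextD_eq => g Dg; apply/idP/idP; first exact: le_lt_trans.
    by move=> cg; rewrite ltNge; apply/negP => /(gc _ Dg); rewrite leNgt cg.
  move: nx; rewrite /phi hx px nextx restr_restr ?(ltW xs) //; last first.
    exact: le_trans (prevD_le _ _) xc.
  rewrite labE; case: ifP => [rx _|_ nf]; first by right; split=> //; exact: le_trans (ltW xs) sn.
  by left; right; split=> // ox; apply: nf; rewrite ox.
rewrite !finite_setU; split; first split.
- exact: finite_ladder_below.
- exact: own_finite.
- by apply: finite_inj_lt => x y; exact: rk_inj.
Qed.

Lemma S_subtree : subtree tree S.
Proof.
split=> [s|s t _|s Ss a]; [exact: sys_sub|exact: sys_down|].
have [t [St ta st]] : exists t, [/\ S t, ht t = Order.max a (ht s) & ext_le s t].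
  by apply: (extendible_le (@S_ext _) Ss); rewrite le_max lexx orbT.
by exists t; split=> //; rewrite ta le_max lexx.
Qed.

(** Where [E] is guessed at a limit [e] of [R], every node of [S] of height [e] has a proper
    predecessor in [E]. A member of [A] of height at least [e] would lie above such a predecessor,
    contradicting either clause of [E]. *)
Lemma S_antichain (A : set (binseq O)) : A `<=` S -> antichain A -> countable A.
Proof.
move=> AS aA.
pose E := [set t | S t /\ ((exists2 u, A u & ext_le u t) \/
  forall u, A u -> ~ comparable_nodes u t)].
have ET : E `<=` tree by move=> t [/sys_sub].
have /choice[wit witP] : forall s, exists t, S s -> [/\ S t, ext_le s t & E t].
  move=> s; have [Ss|nS] := pselect (S s); last by exists s.
  have [[a Aa [as_|sa]]|na] := pselect (exists2 u, A u & comparable_nodes u s).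
  - exists s => _; split=> //; first exact: ext_le_refl.
    by split=> //; left; exists a.
  - exists a => _; split=> //; first exact: AS.
    by split; [exact: AS|left; exists a => //; exact: ext_le_refl].
  - exists s => _; split=> //; first exact: ext_le_refl.
    by split=> //; right=> a Aa cas; apply: na; exists a.
(* [h x] bounds the heights of the witnesses for level [x], so [E] is dense below every [g] closed
   under [h]. *)
have /choice[h hP] : forall x, exists u, forall s, level S x s -> ht (wit s) < u.
  move=> x; have [|u uP] := @strict_bound _ _ hO ((ht \o wit) @` level S x).
    apply: countable_img; apply: countable_subset (countable_level x).
    by move=> t [/sys_sub].
  by exists u => s Ss; apply: uP; exists s.
pose R := [set g | D g /\ forall s, S s -> ht s < g ->
  exists t, [/\ S t, ht t < g, ext_le s t & E t]].
have uR : unbounded R.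
  move=> a; have [g [ag Dg gc _ gh]] := club_meet h a D0club unboundedT.
  exists g => //; split=> // s Ss sg; have [St st Et] := witP s Ss.
  by exists (wit s); split=> //; apply: lt_trans (hP (ht s) s _) (gh _ sg).
have [D1 [clD1 D1W]] := hguess (encode E).
have [e [_ D1e ec [le lR] _]] := club_meet id bot clD1 uR.
apply: countable_subset (countable_tree_below e) => t At; split.
  exact: sys_sub (AS _ At).
rewrite ltNge; apply/negP => et.
have hr : ht (restr t e) = e by exact: ht_restr.
have Sr : S (restr t e) by apply: sys_down (AS _ At); exact: restr_le.
have [_ _] := (sysE _ _ _ _).1 Sr; rewrite hr => -[|_].
  by split=> // a /lR[g [[Dg _] ag ge]]; exists g.
rewrite hr => /(_ _ (proj1 (D1W e D1e)))[|x].
  move=> a /lR[g [[Dg gP] ag ge]]; exists g; split=> // s [Ss _] sg.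
  have [u [Su ug su Eu]] := gP s Ss sg; have ue := lt_trans ug ge.
  by exists u; split=> //; apply/guess_encode.
rewrite hr => xe; have xt := le_trans (ltW xe) et.
rewrite restr_restr ?(ltW xe) // => /guess_encode; rewrite ht_restr // => /(_ ET ec xe)[_].
have rt := restr_le xt.
move=> [[a Aa ax]|/(_ t At)]; last by apply; right.
apply: (aA a t Aa At); last by left; exact: ext_le_trans rt.
move=> ta; have := ext_le_ht ax; rewrite ht_restr // ta leNgt.
by rewrite (lt_le_trans xe et).
Qed.

Lemma S_suslin : suslin_tree S.
Proof.
split; last exact: S_antichain.
split.
- by move=> s t; exact: sys_down.
- move=> a; have [t [St hta _]] := extendible_le (@S_ext a) S_root (botP a).
  by exists t.
- move=> a; apply: countable_subset (countable_level a) => t [St hta].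
  by split=> //; exact: sys_sub St.
- by move=> A AS; apply: tree_chain => t /AS; exact: sys_sub.
Qed.

End Uniformization.

End Construction.

(** * Choice of the parameters and assembly *)

Theorem mainTheorem16 (d : Order.disp_t) (O : orderType d)
    (hO : is_omega1 O) (hdiamond : diamond_plus O)
    (C : O -> set O) (hC : ladder_system C) :
  exists T : set (binseq O),
    aronszajn_tree T /\
    forall f : O -> O -> nat, monochromatic C f ->
      exists (S : set (binseq O)) (phi : binseq O -> nat),
        uniformization T C f S phi /\ suslin_tree S.
Proof.
have [W [hW hguess]] := hdiamond.
have [bot botP] := exists_bottom hO.
have /choice[rk rk_inj'] : forall e : O, exists r : O -> nat,
    forall x y, x <= e -> y <= e -> r x = r y -> x = y.
  move=> e; have /countable_injP[r rinj] := countable_le hO e.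
  by exists r => x y xe ye; apply: rinj; rewrite inE.
have rk_inj e x y := rk_inj' e x y.
have [own [own_le own_finite]] := exists_owner hC rk_inj.
have [code code_inj] := exists_pairing hO.
have /choice[idx idx_inj] : forall L : set (binseq O), exists r : binseq O -> nat,
    countable L -> forall s t, L s -> L t -> r s = r t -> s = t.
  move=> L; have [/countable_injP[r rinj]|_] := boolP (countable L); last by exists (fun=> 0%N).
  by exists r => _ s t Ls Lt; apply: rinj; rewrite inE.
have /choice[lab lab_onto] : forall F : set (set (binseq O)),
    exists k : binseq O -> nat * nat, countable F ->
    (forall A, F A -> forall l, exists2 t, A t & ~ List.In t l) ->
    forall A p, F A -> exists2 t, A t & k t = p.
  move=> F; have [[A0 FA0]|nF] := pselect (F !=set0); last first.
    by exists (fun=> (0, 0)%N) => _ _ A p FA; case: nF; exists A.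
  have [cF|ncF] := boolP (countable F); last by exists (fun=> (0, 0)%N).
  have [inf|ninf] := pselect (forall A, F A -> forall l, exists2 t, A t & ~ List.In t l);
    last by exists (fun=> (0, 0)%N).
  have [I IE] := countable_enum cF FA0.
  have [i l|k kP] := @surjective_labelling _ I.
    by apply: inf; rewrite -IE; exists i.
  by exists k => _ _ A p; rewrite -IE => -[i _ <-]; exact: kP.
have /choice[sel selP] : forall P : set (binseq O), exists t, P !=set0 -> P t.
  move=> P; have [[t Pt]|nP] := pselect (P !=set0); first by exists t.
  by exists (mknode bot (fun=> false)).
pose T := tree hO C W bot rk own code idx lab sel.
exists T; split; first exact: tree_aronszajn.
(* At limits [f1 a] is the constant value of [f a] on [C a]. *)
move=> f fmono; pose f1 a := f a (xget a (C a)).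
(* Guessing [D0] itself along with the coded graph of [f1] lets a level reconstruct the subtree
   below it. *)
have [D0 [D0club D0W]] := hguess [set code a (f1 a) | a in setT].
pose D := D0 `&` closed_code code.
pose S := sys hO C W bot rk own code idx lab T f1 D.
exists S, (phi bot rk own lab f1 D S); split; last exact: S_suslin.
split; first exact: S_subtree.
move=> s Ss ls; have fin := S_uniformizes hC botP rk_inj own_finite D0club Ss ls.
apply: sub_finite_set fin => x /= [Cx nx]; split=> //.
by rewrite /f1 (fmono _ ls _ _ (xgetI (ht s) Cx) Cx).
Qed.
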